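(* Let $A=\mathbb{F}_{p^k}$ be a finite field with $p$ prime, and let $u$ be a nontrivial upcycle for $A^n$ with diamondicity $d=1$. Then no De Bruijn lift of $u$ has the R-3 autocorrelation property.
   Context: Let $A$ be an alphabet with $a=|A|\ge 2$ letters and $\diamond\notin A$ a wildcard symbol (''diamond''). A partial word is a finite sequence over $A\cup\{\diamond\}$; a cyclic partial word $u=(u_1\cdots u_N)$ is cyclically ordered, with indices taken modulo $N$. A partial word $x$ covers a partial word $y$ of the same length if for each $i$ either $x_i=\diamond$ or $x_i=y_i$; a cyclic partial word covers a cyclic partial word of the same length if this holds for a suitable alignment (rotation). For $n\ge 1$, an upcycle for $A^n$ is a cyclic partial word $u=(u_1\cdots u_N)$ such that for each word $y\in A^n$ there is exactly one position $i\in\{1,\dots,N\}$ such that the window $u_i\cdots u_{i+n-1}$ covers $y$. It is known that the diamonds of an upcycle are $n$-periodic, so all windows contain the same number $d$ of diamonds, called the diamondicity; then $u$ has length $a^{n-d}$. An upcycle is nontrivial if it contains at least one diamond and at least one letter. A De Bruijn cycle for $A^n$ is an upcycle for $A^n$ with no diamonds. $u^{(q)}$ denotes the cyclic concatenation of $q$ copies of $u$. A De Bruijn lift of an upcycle $u$ for $A^n$ with diamondicity $d\geq 1$ is a De Bruijn cycle $w$ for $A^n$ that is covered by $u^{(a^d)}$. Given a De Bruijn cycle $w$ for $A^n$ with $A=\mathbb{F}_{p^k}$, the modified De Bruijn cycle $\widehat{w}$ is the cyclic word of length $a^n-1$ obtained from $w$ by deleting one $0$ from the unique occurrence of $0^n$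 in $w$. For a cyclic word $x=(x_1\cdots x_N)$ over $\mathbb{F}_{p^k}$ and $\tau\in\mathbb{Z}$, the autocorrelation at shift $\tau$ is $A(x,\tau)=\sum_{i=1}^N\xi^{\mathrm{Tr}(x_{i+\tau}-x_i)}$, where $\xi=e^{2\pi\mathrm{i}/p}$ and $\mathrm{Tr}(y)=y+y^p+\cdots+y^{p^{k-1}}$ is the trace $\mathbb{F}_{p^k}\to\mathbb{F}_p$. The cyclic word $x$ is a perfect autocorrelation sequence if $A(x,\tau)=-1$ for all $\tau\not\equiv 0\pmod N$. A De Bruijn cycle $w$ has the R-3 property if $\widehat{w}$ is a perfect autocorrelation sequence. *)

(* Defs.v *)
From HB Require Import structures.
From mathcomp Require Import all_boot all_order all_algebra all_field.
From mathcomp Require Import reals trigo.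
From mathcomp Require Import complex.

Set Implicit Arguments.
Unset Strict Implicit.
Unset Printing Implicit Defensive.

Import Order.TTheory GRing.Theory Num.Theory.

(* Partial words over A are sequences over [option A], with [None] as the     *)
(* diamond.  A cyclic (partial) word is represented by one of its linear      *)
(* readings; positions are counted from 0 and indices are taken modulo the    *)
(* length.                                                                    *)

Section Words.
Variable A : finType.
Implicit Types (u x y : seq (option A)) (w : seq A).

Definition window (T : Type) (x0 : T) (s : seq T) (i n : nat) : seq T :=
  [seq nth x0 s ((i + j) %% size s) | j <- iota 0 n].

(* [all2] is false on sequences of different lengths. *)
Definition covers x y : bool :=
  all2 (fun a b => (a == None) || (a == b)) x y.

Definition cyclic_covers x y : Prop := exists r : nat, covers (rot r x) y.

Definition total w : seq (option A) := map some w.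

Definition upcycle (n : nat) u : Prop :=
  forall y : n.-tuple A,
    exists! i : 'I_(size u), covers (window None u i n) (total y).

Definition diamondicity (n : nat) u (d : nat) : Prop :=
  forall i : 'I_(size u), count_mem None (window None u i n) = d.

Definition nontrivial u : bool := has (pred1 None) u && has (predC1 None) u.

Definition de_bruijn_cycle (n : nat) w : Prop := upcycle n (total w).

Definition cyclic_power (q : nat) u : seq (option A) := flatten (nseq q u).

Definition de_bruijn_lift (n d : nat) u w : Prop :=
  de_bruijn_cycle n w /\ cyclic_covers (cyclic_power (#|A| ^ d) u) (total w).

End Words.

Local Open Scope ring_scope.

(* The first 0 of the unique (cyclic) occurrence of 0^n is deleted; deleting  *)
(* another 0 of that occurrence gives the same cyclic word.                   *)
Definition modified (F : finFieldType) (n : nat) (w : seq F) : seq F :=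
  let i := find (fun i => window 0 w i n == nseq n 0) (iota 0 (size w)) in
  take i w ++ drop i.+1 w.

(* The trace F -> F_p for #|F| = p ^ k, where c : 'F_p is identified with its *)
(* image c%:R in F.  The default value is never used: see [traceE].           *)
Definition trace (F : finFieldType) (p k : nat) (y : F) : 'F_p :=
  odflt 0 [pick c : 'F_p | (c : nat)%:R == \sum_(i < k) y ^+ (p ^ i)].

Lemma traceE (F : finFieldType) (p k : nat) (y : F) :
  prime p -> #|F| = (p ^ k)%N ->
  (trace p k y : nat)%:R = \sum_(i < k) y ^+ (p ^ i) :> F.
Proof.
move=> p_pr cardF; rewrite /trace; case: pickP => [c /eqP //| noc].
have k_gt0 : (0 < k)%N.
  by case: (k) cardF (finNzRing_gt1 F) => // ->; rewrite expn0.
have pcharF : p \in [pchar F] by exact: card_finPcharP cardF p_pr.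
have natr_eq0 (m : nat) : (m%:R == 0 :> F) = (p %| m)%N.
  by rewrite -(dvdn_pcharf pcharF).
set t := \sum_(i < k) y ^+ (p ^ i) in noc *.
have tp : t ^+ p = t.
  rewrite -(pFrobenius_autE pcharF) rmorph_sum /t.
  case: (k) k_gt0 cardF => // m _ cardF.
  rewrite big_ord_recr [RHS]big_ord_recl /= addrC; congr (_ + _).
    by rewrite pFrobenius_autE -exprM -expnSr -cardF expf_card expn0 expr1.
  by apply: eq_bigr => i _; rewrite pFrobenius_autE -exprM -expnSr.
have p_gt1 := prime_gt1 p_pr.
have size_q : size ('X^p - 'X : {poly F}) = p.+1.
  by rewrite size_polyDl size_polyXn // size_polyN size_polyX ltnS.
have root_q (z : F) : root ('X^p - 'X) z = (z ^+ p == z).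
  by rewrite rootE !hornerE subr_eq0.
pose rs := [seq (val c)%:R : F | c <- enum 'F_p].
have rsP : all (root ('X^p - 'X)) (t :: rs).
  rewrite /= root_q tp eqxx /=; apply/allP => _ /mapP[c _ ->].
  by rewrite root_q -(pFrobenius_autE pcharF) rmorph_nat.
have rsU : uniq (t :: rs).
  rewrite cons_uniq; apply/andP; split.
    by apply/mapP => -[c _ tE]; move: (noc c); rewrite tE eqxx.
  rewrite /rs map_inj_uniq ?enum_uniq // => c c' cc'; apply: val_inj.
  have ltp (e : 'F_p) : (val e < p)%N by have := ltn_ord e; rewrite [ltnRHS]Fp_cast.
  wlog le_cc' : c c' cc' / (val c <= val c')%N.
    by move=> W; case: (leqP (val c) (val c')) => [|/ltnW] /W ->.
  apply/eqP; rewrite eqn_leq le_cc' /= -subn_eq0 -leqn0 leqNgt.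
  apply/negP => lt0; have := natr_eq0 (val c' - val c)%N.
  rewrite natrB // cc' subrr eqxx => /esym /(dvdn_leq lt0).
  by rewrite leqNgt (leq_ltn_trans (leq_subr _ _) (ltp c')).
have q_neq0 : ('X^p - 'X : {poly F}) != 0 by rewrite -size_poly_eq0 size_q.
have := max_poly_roots q_neq0 rsP rsU.
by rewrite size_q /= size_map -cardE card_Fp // ltnn.
Qed.

(* e^(2 pi i / p) *)
Definition xi (R : realType) (p : nat) : R[i] :=
  Complex (cos (2 * pi / p%:R)) (sin (2 * pi / p%:R)).

(* The term of index i : 'I_N uses the letters at positions i and             *)
(* (i + tau) mod N.                                                           *)
Definition autocorrelation (R : realType) (F : finFieldType) (p k : nat)
    (x : seq F) (tau : int) : R[i] :=
  \sum_(i < size x)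
    xi R p ^+ (trace p k (nth 0 x `|((i%:Z + tau) %% (size x)%:Z)%Z|%N
                          - nth 0 x i) : nat).

Definition perfect_autocorrelation (R : realType) (F : finFieldType)
    (p k : nat) (x : seq F) : Prop :=
  forall tau : int, ~~ ((size x)%:Z %| tau)%Z ->
    autocorrelation R p k x tau = -1.

Definition R3_property (R : realType) (F : finFieldType) (p k n : nat)
    (w : seq F) : Prop :=
  perfect_autocorrelation R p k (modified n w).

(* Main.v *)
Require Import Defs.
From HB Require Import structures.
From mathcomp Require Import all_boot all_order all_algebra all_field.
From mathcomp Require Import reals trigo complex.
From mathcomp Require Import zify ring lra.

(* Let N = |u|, a = |F|, L = a N, let v be w read from the start of its       *)
(* occurrence of 0^n, and let chi be the additive character defining the      *)
(* autocorrelation; the first letter of v is the one that is deleted.  The    *)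
(* autocorrelation of the modified cycle at shift N is                        *)
(*   sum_(1 <= i < L - N) chi (v (i + N) - v i)                               *)
(*   + sum_(0 <= i < N) chi (v (i + 1) - v (i + L - N)).                      *)
(* In the first sum all terms without diamonds are 1.  In the second sum the  *)
(* pairs of letters of u contribute 0, because in a De Bruijn cycle adjacent  *)
(* letters are equidistributed and so are the values of v at the a copies of  *)
(* a diamond.  The N/n diamonds of a period spoil at most (a - 1) N/n terms   *)
(* of the first sum and 2 N/n of the second; one of the latter is 1, since    *)
(* the diamond in the occurrence of 0^n is neither its first nor its last     *)
(* letter.  Bounding the other real parts below by -1, the real part is at    *)
(* least ((a - 1) n - 2 a) N/n + 1.  This exceeds -1, as n >= 3 and the only  *)
(* pair with n >= 3 and (a - 1) n < 2 a, namely a = 2 and n = 3, is excluded  *)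
(* since n divides N = a^(n-1).                                               *)

Set Implicit Arguments.
Unset Strict Implicit.
Unset Printing Implicit Defensive.
Import Order.TTheory GRing.Theory Num.Theory.
Local Open Scope ring_scope.

(** Shifting by N moves every letter of u onto a copy of itself, so the lifted cycle is nearly
    N-periodic and its autocorrelation at N is too large. [autocorrelation_split] gives the two
    sums: the deleted letter offsets the wrapped part by one, so there neighbours are compared. The
    diamonds are controlled by two facts: they make up a fraction 1/n of u ([card_diamonds]), and
    the a copies of a diamond carry every letter exactly once ([diamond_values_bij]). The second
    fact, with [adjacent_sum], yields [letter_pairs_sum]. [interior_diamond] supplies both n >= 3
    and one diamond term equal to 1. The estimate [autocorrelation_bound] is proved for an abstract
    real function [g] and applied to the real part of [chi]. *)

(** * Sums over periods and blocks *)

Section PeriodicSums.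
Variables (V : Type) (idx : V) (op : Monoid.com_law idx).

Lemma big_periodic_shift (N s : nat) (h : nat -> V) :
  (forall i, h (i + N)%N = h i) ->
  \big[op/idx]_(i < N) h (i + s)%N = \big[op/idx]_(i < N) h i.
Proof.
move=> hN; elim: s => [|s IH]; first by apply: eq_bigr => i _; rewrite addn0.
rewrite -{}IH; case: N hN => [|N] hN; first by rewrite !big_ord0.
rewrite big_ord_recr [RHS]big_ord_recl /= Monoid.mulmC; congr (op _ _).
  by rewrite add0n -[RHS]hN addnC addSnnS.
by apply: eq_bigr => i _; rewrite /bump /= addnS.
Qed.

Lemma big_blocks (a N : nat) (h : nat -> V) :
  \big[op/idx]_(i < a * N) h i =
  \big[op/idx]_(r < N) \big[op/idx]_(j < a) h (r + j * N)%N.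
Proof.
rewrite exchange_big /=; elim: a => [|a IH]; first by rewrite !big_ord0.
rewrite big_ord_recr /= -IH -(big_mkord xpredT) mulSnr.
rewrite (big_cat_nat _ (leq_addr N (a * N)%N)) //= big_mkord; congr (op _ _).
rewrite -{1}[(a * N)%N]add0n big_addn addKn big_mkord.
by apply: eq_bigr.
Qed.

End PeriodicSums.

(** * The lower bound for a lift read from its occurrence of 0^n *)

Section LiftedCycle.
Variables (R : realFieldType) (F : finFieldType) (g : F -> R).
Variables (n N : nat) (w : nat -> F) (dia : pred nat).
Let a := #|F|.
Let L := (a * N)%N.
Hypotheses (g0 : g 0 = 1) (g_ge : forall y, -1 <= g y) (g_sum : \sum_y g y = 0).
Hypotheses (n_gt1 : (1 < n)%N) (w_per : forall i, w (i + L)%N = w i).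
Hypotheses (dia_per : forall i, dia (i + N)%N = dia i).
Hypothesis w_letter : forall i, ~~ dia i -> w (i + N)%N = w i.
Hypothesis dia_window : forall i, (\sum_(j < n) dia (i + j) = 1)%N.
Hypothesis w_bij :
  bijective (fun i : 'I_L => [ffun j : 'I_n => w (i + j)%N]).
Hypothesis w_zeros : forall j, (j < n)%N -> w j = 0.

Lemma alphabet_gt1 : (1 < a)%N. Proof. exact: finNzRing_gt1. Qed.

Lemma dia_perM i j : dia (i + j * N)%N = dia i.
Proof. by elim: j => [|j IH]; rewrite ?addn0 // mulSnr addnA dia_per. Qed.

Lemma w_letterM i j : ~~ dia i -> w (i + j * N)%N = w i.
Proof.
move=> di; elim: j => [|j IH]; first by rewrite addn0.
by rewrite mulSnr addnA w_letter // dia_perM.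
Qed.

Lemma dia_unique i j j' : (j < n)%N -> (j' < n)%N ->
  dia (i + j)%N -> dia (i + j')%N -> j = j'.
Proof.
move=> jn j'n dj dj'; apply/eqP/negPn/negP => ne.
have := dia_window i; rewrite (bigD1 (Ordinal jn)) //= dj.
by rewrite (bigD1 (Ordinal j'n)) ?dj' //= -val_eqE eq_sym.
Qed.

Lemma dia_exists i : exists2 j, (j < n)%N & dia (i + j)%N.
Proof.
have [/existsP[j dj]|] := boolP [exists j : 'I_n, dia (i + j)%N].
  by exists j.
rewrite negb_exists => /forallP nd; have := dia_window i.
by rewrite big1 // => j _; rewrite (negPf (nd j)).
Qed.

(** Double counting: each of the N windows holds one diamond, and each diamond lies in n windows. *)
Lemma card_diamonds : (n * \sum_(i < N) dia i = N)%N.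
Proof.
transitivity (\sum_(i < N) \sum_(j < n) dia (i + j))%N; last first.
  by rewrite -[RHS]card_ord -sum1_card; apply: eq_bigr => i _; exact: dia_window.
rewrite exchange_big /=.
rewrite [RHS](eq_bigr (fun=> \sum_(i < N) dia i)%N) => [|j _].
  by rewrite sum_nat_const card_ord.
rewrite (@big_periodic_shift _ _ _ N j (fun i => dia i : nat)) // => i.
by rewrite dia_per.
Qed.

Lemma window_inj i i' : (i < L)%N -> (i' < L)%N ->
  (forall j, (j < n)%N -> w (i + j)%N = w (i' + j)%N) -> i = i'.
Proof.
move=> iL i'L eq_w; have /bij_inj inj := w_bij.
suff /inj[] : [ffun j : 'I_n => w (Ordinal iL + j)%N] =
              [ffun j : 'I_n => w (Ordinal i'L + j)%N] by [].
by apply/ffunP => j; rewrite !ffunE eq_w.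
Qed.

Lemma card_words : L = (a ^ n)%N.
Proof. by rewrite -[LHS]card_ord (bij_eq_card w_bij) card_ffun card_ord. Qed.

Lemma N_gt1 : (1 < N)%N.
Proof.
have : (0 < L)%N by rewrite card_words expn_gt0 ltnW ?alphabet_gt1.
rewrite muln_gt0 => /andP[_ N_gt0]; rewrite ltn_neqAle N_gt0 andbT.
apply/eqP => N1; have : (n %| N)%N by rewrite -card_diamonds dvdn_mulr.
by rewrite -N1 dvdn1 => /eqP n1; move: n_gt1; rewrite n1.
Qed.

Lemma block_ltn r j : (r < N)%N -> (j < a)%N -> (r + j * N < L)%N.
Proof.
move=> rN ja; apply: (@leq_trans (j.+1 * N)); first by rewrite mulSn ltn_add2r.
by rewrite leq_mul2r ja orbT.
Qed.

(** The window starting at a diamond has only letters after it, and these agree in all copies. Equal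
    values at two copies would thus repeat a whole window. *)
Lemma diamond_values_inj r : (r < N)%N -> dia r ->
  {in gtn a &, injective (fun j => w (r + j * N)%N)}.
Proof.
move=> rN dr j j' ja j'a eq_w; have N0 : (0 < N)%N := ltnW N_gt1.
suff /eqP : (r + j * N = r + j' * N)%N by rewrite eqn_add2l eqn_pmul2r // => /eqP.
apply: window_inj => [||m mn]; rewrite ?block_ltn //.
case: m => [|m] in mn *; first by rewrite !addn0.
have dN : ~~ dia (r + m.+1).
  apply/negP => dm; have := @dia_unique r _ _ (ltnW n_gt1) mn.
  by rewrite addn0 => /(_ dr dm).
by rewrite ![(r + _ * _ + _)%N]addnAC !w_letterM.
Qed.

Lemma diamond_values_bij r : (r < N)%N -> dia r ->
  bijective (fun j : 'I_a => w (r + j * N)%N).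
Proof.
move=> rN dr; apply: inj_card_bij; last by rewrite card_ord.
by move=> i j /(diamond_values_inj rN dr) ij; apply/val_inj/ij; exact: ltn_ord.
Qed.

Lemma diamond_values_sum r (h : F -> R) : (r < N)%N -> dia r ->
  \sum_(j < a) h (w (r + j * N)%N) = \sum_y h y.
Proof.
by move=> rN dr; rewrite [RHS](reindex _ (onW_bij _ (diamond_values_bij rN dr))).
Qed.


(** As n >= 2, the windows of a De Bruijn cycle show all adjacent pairs equally often, and [g] sums
    to 0 over F. *)
Lemma adjacent_sum : \sum_(i < L) g (w i.+1 - w i) = 0.
Proof.
have n_gt0 := ltnW n_gt1.
pose j0 := Ordinal n_gt0; pose j1 := Ordinal n_gt1.
pose S := \sum_(y : {ffun 'I_n -> F}) g (y j1 - y j0).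
have -> : \sum_(i < L) g (w i.+1 - w i) = S.
  rewrite /S (reindex _ (onW_bij _ w_bij)); apply: eq_bigr => i _.
  by rewrite !ffunE /= addn0 addn1.
(* S is unchanged when every second letter is translated by c; average over c. *)
pose shift c (y : {ffun 'I_n -> F}) := [ffun j => if j == j1 then y j + c else y j].
have shiftK c : cancel (shift c) (shift (- c)).
  by move=> y; apply/ffunP => j; rewrite !ffunE; case: eqP => // _; rewrite addrK.
have shift_bij c : bijective (shift c).
  by exists (shift (- c)) => // y; rewrite -{1}[c]opprK shiftK.
have S_shift c : S = \sum_(y : {ffun 'I_n -> F}) g (y j1 - y j0 + c).
  rewrite /S (reindex _ (onW_bij _ (shift_bij c))); apply: eq_bigr => y _.
  by rewrite !ffunE eqxx /= addrAC.
have : \sum_(c : F) S = 0.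
  rewrite (eq_bigr _ (fun c _ => S_shift c)) exchange_big /=; apply: big1 => y _.
  rewrite -[RHS]g_sum [RHS](reindex (fun c => y j1 - y j0 + c)) //.
  by apply: onW_bij; exists (fun c => - (y j1 - y j0) + c) => c; rewrite ?addKr ?addNKr.
move/eqP; rewrite sumr_const -[#|_|]/a -mulr_natl mulf_eq0 pnatr_eq0.
by have := alphabet_gt1; case: a => //= ? _ /eqP.
Qed.

Let letters i := ~~ dia i && ~~ dia i.+1.

Lemma dia_succ i : dia i -> ~~ dia i.+1.
Proof.
move=> di; apply/negP => di1; have := @dia_unique i _ _ (ltnW n_gt1) n_gt1.
by rewrite addn0 addn1 => /(_ di di1).
Qed.

(** Group [adjacent_sum] by residues mod N. A pair of letters contributes [a] equal terms. A pair
    with a diamond contributes 0, because the diamond runs through F while its neighbour stays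
    fixed. *)
Lemma letter_pairs_sum : \sum_(i < N | letters i) g (w i.+1 - w i) = 0.
Proof.
have := adjacent_sum; rewrite /L (@big_blocks _ _ _ _ _ (fun i => g (w i.+1 - w i))).
rewrite (bigID (fun i : 'I_N => letters i)) /= [X in _ + X]big1 ?addr0 => [|r].
  rewrite (eq_bigr (fun r : 'I_N => g (w r.+1 - w r) *+ a)) => [|r /andP[dr dr1]].
    rewrite sumrMnl => /eqP; rewrite mulrn_eq0 => /orP[|/eqP//].
    by have := alphabet_gt1; case: a.
  under eq_bigr => j _ do rewrite -addSn !w_letterM //.
  by rewrite sumr_const card_ord.
rewrite negb_and !negbK => /orP[dr|dr1].
  under eq_bigr => j _ do rewrite -addSn (w_letterM _ (dia_succ dr)).
  rewrite (@diamond_values_sum r (fun y => g (w r.+1 - y))) // -[RHS]g_sum.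
  by rewrite [RHS](reindex_inj (inv_inj (subKr (w r.+1)))).
have dr : ~~ dia r by apply/negP => /dia_succ; rewrite dr1.
under eq_bigr => j _ do rewrite (w_letterM _ dr).
have [r1N|] := ltnP r.+1 N.
  under eq_bigr => j _ do rewrite -addSn.
  rewrite (@diamond_values_sum r.+1 (fun y => g (y - w r))) // -[RHS]g_sum.
  by rewrite [RHS](reindex_inj (addIr (- w r))).
(* The diamond at [r.+1 = N] opens the next block, so its copies are those of position 0 shifted
   cyclically by one block. *)
rewrite leq_eqVlt ltnS leqNgt ltn_ord orbF => /eqP rN.
have d0 : dia 0 by rewrite -dia_per add0n rN.
pose h j := g (w (j * N)%N - w r).
transitivity (\sum_(j < a) h j); last first.
  transitivity (\sum_(j < a) g (w (0 + j * N)%N - w r)) => //.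
  rewrite (@diamond_values_sum 0 (fun y => g (y - w r))) // ?(ltnW N_gt1) // -[RHS]g_sum.
  by rewrite [RHS](reindex_inj (addIr (- w r))).
rewrite -[RHS](@big_periodic_shift _ _ _ a 1 h).
  by apply: eq_bigr => j _; rewrite /h mulnDl mul1n -addSn -rN addnC.
by move=> j; rewrite /h mulnDl w_per.
Qed.

(** The case r = N is included because r = n will be taken, and n may equal N; copies of N are
    copies of 0, with copy 0 reached as copy [a.-1] by wrapping around. *)
Lemma diamond_zero r : (r <= N)%N -> dia r ->
  exists2 j, (j < a)%N & w (r + j * N)%N = 0.
Proof.
have zero_lt r' : (r' < N)%N -> dia r' -> exists2 j, (j < a)%N & w (r' + j * N)%N = 0.
  move=> rN dr; have [f _ fK] := diamond_values_bij rN dr.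
  by exists (f 0); rewrite ?fK.
rewrite leq_eqVlt => /orP[/eqP->|]; last exact: zero_lt.
rewrite -{1}[N]add0n dia_per => /(zero_lt _ (ltnW N_gt1))[[|j] ja wj].
  exists a.-1; rewrite ?prednK ?(ltnW alphabet_gt1) //.
  by rewrite -mulSn prednK ?(ltnW alphabet_gt1) // -[RHS]wj !add0n -[RHS]w_per.
by exists j; [exact: ltnW | rewrite -mulSn].
Qed.

Lemma n_leN : (n <= N)%N.
Proof.
apply: dvdn_leq; first exact: ltnW N_gt1.
by rewrite -card_diamonds dvdn_mulr.
Qed.

(* If the diamond lay at an end of the window, shifting the window by one     *)
(* position would give a second window covering [0^n].                        *)
Lemma interior_diamond : exists2 i, (i.+2 < n)%N & dia i.+1.
Proof.
have N_gt1 := N_gt1; have n_leN := n_leN.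
have L0 : (0 < L)%N by rewrite muln_gt0 (ltnW alphabet_gt1) ltnW.
have no_zeros p : (0 < p < L)%N -> ~ (forall m, (m < n)%N -> w (p + m)%N = 0).
  case/andP=> p0 pL zp; suff p_eq0 : p = 0%N by rewrite p_eq0 in p0.
  by apply: window_inj => // m mn; rewrite zp // w_zeros.
have not_dia j i : (i < n)%N -> dia i -> (j < n)%N -> j != i -> ~~ dia j.
  by move=> iN di jn; apply: contra => dj; apply/eqP/(@dia_unique 0 j i).
have [[|i] iN] := dia_exists 0; rewrite add0n => di.
  (* Moving the window from 0 to 1 drops its only diamond, so the entering position n must be
     one. *)
  have dn : dia n.
    have [j jn] := dia_exists 1; rewrite add1n => dj.
    suff -> : n = j.+1 by [].
    apply/eqP; rewrite eq_sym eqn_leq jn leqNgt.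
    by apply/negP => j1n; move: dj; apply/negP; exact: (not_dia _ 0).
  have [j ja wj] := diamond_zero n_leN dn.
  exfalso; apply: (no_zeros (1 + j * N)%N); first by rewrite block_ltn.
  move=> m mn; rewrite addnAC add1n.
  have [m1n|] := ltnP m.+1 n.
    by rewrite w_letterM ?w_zeros //; apply: (not_dia _ 0).
  by move=> nm; rewrite (_ : m.+1 = n) //; apply/eqP; rewrite eqn_leq mn.
have [i2n|] := ltnP i.+2 n; first by exists i.
move=> ni; have {}ni : n = i.+2 by apply/eqP; rewrite eqn_leq ni.
(* [N.-1] stands for position -1: moving the window back by one drops the diamond at n - 1, so the
   entering position is one. *)
have dN : dia N.-1.
  have [[|j] jn] := dia_exists N.-1; first by rewrite addn0.
  rewrite addnS -addSn prednK ?(ltnW N_gt1) // addnC dia_per => dj.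
  suff : ~~ dia j by rewrite dj.
  apply: (not_dia j i.+1) => //; first exact: ltnW.
  by move: jn; rewrite ni neq_ltn !ltnS => ->.
have [j ja wj] := diamond_zero (leq_pred N) dN.
exfalso; apply: (no_zeros (N.-1 + j * N)%N).
  rewrite block_ltn ?prednK ?(ltnW N_gt1) // andbT; lia.
case=> [|m] mn; first by rewrite addn0.
have -> : (N.-1 + j * N + m.+1 = m + j.+1 * N)%N by lia.
rewrite w_letterM ?w_zeros 1?ltnW //.
apply: (not_dia m i.+1) => //; first exact: ltnW.
by move: mn; rewrite ni neq_ltn !ltnS => ->.
Qed.

Lemma autocorrelation_bound :
  -1 < \sum_(1 <= i < L - N) g (w (i + N)%N - w i)
       + \sum_(i < N) g (w i.+1 - w (i + (L - N))%N).
Proof.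
have [i0 i0n di0] := interior_diamond.
have n_leN := n_leN; have a_gt1 := alphabet_gt1; have N_gt1 := N_gt1.
have LN : (L - N = a.-1 * N)%N by rewrite /L -{2}[N]mul1n -mulnBl subn1.
pose D := (\sum_(i < N) dia i)%N.
have d0 : ~~ dia 0.
  apply/negP => d0; suff : 0%N = i0.+1 by [].
  by apply: (@dia_unique 0) => //; lia.
have aN_gt0 : (0 < a.-1 * N)%N by rewrite muln_gt0; lia.
(* A diamond lowers a term from 1 to at least -1, a loss of 2. The final -1 accounts for the missing
   index 0, whose term is 1. *)
have bound1 : a.-1%:R * (N%:R - 2 * D%:R) - 1
              <= \sum_(1 <= i < L - N) g (w (i + N)%N - w i).
  rewrite lerBlDl LN; set S := \sum_(1 <= i < _) _.
  have -> : 1 + S = \sum_(i < a.-1 * N) g (w (i + N)%N - w i).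
    rewrite -(big_mkord xpredT (fun i => g (w (i + N)%N - w i))) big_ltn //.
    by rewrite w_letter // subrr g0.
  have -> : a.-1%:R * (N%:R - 2 * D%:R) = \sum_(i < a.-1 * N) (1 - 2 * (dia i)%:R) :> R.
    rewrite (@big_blocks _ _ _ _ _ (fun i => 1 - 2 * (dia i)%:R : R)).
    transitivity (\sum_(r < N) a.-1%:R * (1 - 2 * (dia r)%:R) : R).
      rewrite -mulr_sumr sumrB -mulr_sumr -natr_sum sumr_const card_ord //.
    apply: eq_bigr => r _; under eq_bigr => j _ do rewrite dia_perM.
    by rewrite sumr_const card_ord mulr_natl.
  apply: ler_sum => i _; case: (boolP (dia i)) => [di|di] /=.
    by have := g_ge (w (i + N)%N - w i); lra.
  by rewrite w_letter // subrr g0 mulr0 subr0.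
have bound2 : 2 - 2 * D%:R <= \sum_(i < N) g (w i.+1 - w (i + (L - N))%N).
  have i0N : (i0 < N)%N := leq_trans (ltnW (ltnW i0n)) n_leN.
  (* The comparison term is exact on pairs of letters and -1 on pairs with a diamond. The pair [i0],
     [i0.+1] lies inside 0^n, so its term is 1, which is 2 more than -1. *)
  have -> : 2 - 2 * D%:R = \sum_(i < N)
      ((if letters i then g (w i.+1 - w i) else 0) - (dia i)%:R - (dia i.+1)%:R
       + (if i == Ordinal i0N then 2 else 0)).
    rewrite big_split -big_mkcond big_pred1_eq !sumrB /= -big_mkcond /=.
    rewrite letter_pairs_sum -!natr_sum.
    have -> : (\sum_(i < N) dia i.+1 = D)%N.
      rewrite -[RHS](@big_periodic_shift _ _ _ N 1 (fun i => dia i : nat)).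
        by apply: eq_bigr => i _; rewrite addn1.
      by move=> i; rewrite dia_per.
    by rewrite -/D; ring.
  apply: ler_sum => i _; rewrite /letters LN.
  case: eqP => [->|_].
    have di : ~~ dia i0 by apply: contraL di0 => /dia_succ.
    rewrite di0 andbF /= w_letterM // !w_zeros ?(ltnW (ltnW i0n)) ?(ltnW i0n) //.
    by rewrite subrr g0 (negPf di) /= mulr0n; lra.
  have gi := g_ge (w i.+1 - w (i + a.-1 * N)%N).
  case: (boolP (dia i)) => [di|di] /=.
    by case: (dia i.+1) => /=; rewrite ?mulr0n; lra.
  rewrite w_letterM // in gi *.
  by case: (dia i.+1) => /=; rewrite ?mulr0n; lra.
have nDN : (n * D = N)%N := card_diamonds.
have cardL : (a * N = a ^ n)%N := card_words.
have D_gt0 : (0 < D)%N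
  by rewrite lt0n; apply/eqP => D0; move: N_gt1; rewrite -nDN D0 muln0.
have key : (a.-1 * (2 * D) + 2 * D < a.-1 * N + 2)%N.
  have n_gt2 : (2 < n)%N by exact: leq_trans i0n.
  have [a2|a2] := eqVneq a 2%N.
    have [n3|n3] := eqVneq n 3%N; last by rewrite -nDN a2; clear - n_gt2 n3; nia.
    by move: cardL; rewrite -nDN a2 n3; clear; lia.
  have {}a2 : (2 < a)%N by rewrite ltn_neqAle eq_sym a2.
  rewrite -nDN; clear - a2 n_gt2; nia.
have : (a.-1 * (2 * D) + 2 * D)%:R < (a.-1 * N + 2)%:R :> R by rewrite ltr_nat.
rewrite !natrD !natrM; lra.
Qed.

End LiftedCycle.

(** * The additive character given by the trace *)

Section Character.
Variables (R : realType) (F : finFieldType) (p k : nat).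
Hypotheses (p_pr : prime p) (cardF : #|F| = (p ^ k)%N).

Lemma xi_exp m : xi R p ^+ m =
  Complex (cos (2 * pi / p%:R *+ m)) (sin (2 * pi / p%:R *+ m)).
Proof.
elim: m => [|m IH]; first by rewrite !mulr0n cos0 sin0.
rewrite exprS IH (mulrS (2 * pi / p%:R)) cosD sinD /xi; apply/eqP; rewrite eq_complex /=.
by rewrite eqxx addrC /=; apply/eqP; ring.
Qed.

Lemma xi_exp_p : xi R p ^+ p = 1.
Proof.
have p0 : p%:R != 0 :> R by rewrite pnatr_eq0 -lt0n prime_gt0.
rewrite xi_exp -mulr_natr divfK // mulr_natl cos2pi.
by rewrite mulr2n sinD sinpi mul0r mulr0 addr0.
Qed.

Definition chi (y : F) : R[i] := xi R p ^+ (trace p k y : nat).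

Lemma eqn_mod_pchar m m' : p \in [pchar F] -> m%:R = m'%:R :> F -> m = m' %[mod p].
Proof.
move=> pF; wlog le_mm' : m m' / (m' <= m)%N.
  by move=> W; case: (leqP m' m) => [/W//|/ltnW/W E /esym/E].
move=> eq_mm'; apply/eqP; rewrite eqn_mod_dvd // (dvdn_pcharf pF) natrB //.
by rewrite eq_mm' subrr.
Qed.

(** Exponents of [xi] matter only mod p, and their congruence can be tested in F, where the trace is
    a sum of additive Frobenius powers. *)
Lemma chiD x y : chi (x + y) = chi x * chi y.
Proof.
have pF : p \in [pchar F] by exact: card_finPcharP cardF p_pr.
rewrite /chi -exprD -(expr_mod _ xi_exp_p) -[RHS](expr_mod _ xi_exp_p).
congr (_ ^+ _); apply: eqn_mod_pchar => //; rewrite natrD !traceE // -big_split /=.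
apply: eq_bigr => i _; apply: exprDn_pchar.
by rewrite pnatX (eq_pnat _ (pcharf_eq pF)) pnat_id.
Qed.

Lemma chi0 : chi 0 = 1.
Proof.
have xi0 : xi R p != 0.
  apply/eqP => x0; have := xi_exp_p; rewrite x0 expr0n gtn_eqF ?prime_gt0 //=.
  by move/esym/eqP; rewrite oner_eq0.
have chi0 : chi 0 != 0 by rewrite expf_neq0.
by apply: (mulfI chi0); rewrite -chiD addr0 mulr1.
Qed.

Lemma Re_chi_ge y : -1 <= complex.Re (chi y).
Proof. by rewrite /chi xi_exp cos_geN1. Qed.

Lemma sum_chi y : chi y != 1 -> \sum_z chi z = 0.
Proof.
rewrite -subr_eq0 => chiy; apply: (mulfI chiy).
rewrite mulr0 mulrBl mul1r mulr_sumr; apply/eqP; rewrite subr_eq0; apply/eqP.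
by rewrite [RHS](reindex_inj (addrI y)); apply: eq_bigr => z _; rewrite chiD.
Qed.

Lemma ReD (x y : R[i]) : complex.Re (x + y) = complex.Re x + complex.Re y.
Proof. by case: x y => ? ? []. Qed.

Lemma Re_sum (I : Type) (r : seq I) (P : pred I) (h : I -> R[i]) :
  complex.Re (\sum_(i <- r | P i) h i) = \sum_(i <- r | P i) complex.Re (h i).
Proof. exact: (big_morph _ ReD). Qed.

End Character.

(** * Entries of windows, powers and rotations of partial words *)

Section CyclicWords.
Variable A : finType.
Implicit Types (u x y : seq (option A)).

Lemma covers_nth x y s : covers x y ->
  nth None x s = None \/ nth None x s = nth None y s.
Proof.
rewrite /covers; elim: x y s => [|c x IH] [|d y] [|s] //=; try by right.
  by case/andP=> /orP[/eqP|/eqP] -> _; [left | right].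
by case/andP=> _ /IH.
Qed.

Lemma covers_size x y : covers x y -> size x = size y.
Proof. by rewrite /covers all2E => /andP[/eqP]. Qed.

Lemma coversP x y : size x = size y ->
  (forall s, (s < size x)%N -> nth None x s = None \/ nth None x s = nth None y s) ->
  covers x y.
Proof.
rewrite /covers; elim: x y => [|c x IH] [|d y] //= [sxy] xy.
rewrite IH // => [|s sx]; last exact: (xy s.+1).
by case: (xy 0%N isT) => /= ->; rewrite eqxx ?orbT.
Qed.

Lemma nth_window (T : Type) (x0 : T) (s : seq T) i n j : (j < n)%N ->
  nth x0 (window x0 s i n) j = nth x0 s ((i + j) %% size s).
Proof. by move=> jn; rewrite (nth_map 0%N) ?size_iota // nth_iota. Qed.

Lemma size_window (T : Type) (x0 : T) (s : seq T) i n : size (window x0 s i n) = n.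
Proof. by rewrite size_map size_iota. Qed.

Lemma nth_total a0 (w : seq A) s : (s < size w)%N ->
  nth None (Defs.total w) s = Some (nth a0 w s).
Proof. by move=> sw; rewrite (nth_map a0). Qed.

Lemma size_cyclic_power q u : size (cyclic_power q u) = (q * size u)%N.
Proof. by rewrite /cyclic_power size_flatten /shape map_nseq sumn_nseq mulnC. Qed.

Lemma nth_cyclic_power q u s : (s < q * size u)%N ->
  nth None (cyclic_power q u) s = nth None u (s %% size u).
Proof.
rewrite /cyclic_power; elim: q s => [//|q IH] s /=; rewrite mulSn nth_cat.
move=> sq; case: ltnP => us; first by rewrite modn_small.
by rewrite -[in RHS](subnK us) modnDr IH //; lia.
Qed.

Lemma nth_rot_mod (T : Type) (x0 : T) (s : seq T) r i :
  (r <= size s)%N -> (i < size s)%N ->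
  nth x0 (rot r s) i = nth x0 s ((i + r) %% size s).
Proof.
move=> rs iS; rewrite /rot nth_cat size_drop nth_drop.
case: ltnP => [ir|ri]; first by rewrite modn_small addnC //; lia.
have -> : ((i + r) %% size s = i - (size s - r))%N.
  have -> : (i + r = i - (size s - r) + size s)%N by lia.
  by rewrite modnDr modn_small //; lia.
by rewrite nth_take //; lia.
Qed.

Lemma diamond_window_sum n d u m : (0 < size u)%N -> diamondicity n u d ->
  (\sum_(j < n) (nth None u ((m + j) %% size u) == None) = d)%N.
Proof.
move=> u0 du; rewrite -(du (Ordinal (ltn_pmod m u0))) count_map /=.
rewrite -(big_mkord xpredT (fun j => nth None u ((m + j) %% size u) == None : nat)).
rewrite -sum1_count [RHS]big_mkcond /index_iota subn0.
by apply: eq_bigr => j _ /=; rewrite modnDml; case: eqP.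
Qed.

End CyclicWords.

(** * De Bruijn cycles and the deletion of a zero *)

Section DeBruijn.
Variables (F : finFieldType) (n : nat) (w : seq F).
Hypothesis dbw : de_bruijn_cycle n w.
Let L := size w.
Let c s := nth 0 w (s %% L).

Lemma size_de_bruijn_gt0 : (0 < L)%N.
Proof.
have [i _] := dbw [tuple 0 | _ < n].
by rewrite /L -(size_map some w); exact: leq_ltn_trans (ltn_ord i).
Qed.

Lemma de_bruijn_covers i (y : n.-tuple F) :
  covers (window None (Defs.total w) i n) (Defs.total y) <->
  forall j : 'I_n, c (i + j) = tnth y j.
Proof.
have L0 := size_de_bruijn_gt0.
have nthW j : (j < n)%N -> nth None (window None (Defs.total w) i n) j = Some (c (i + j)).
  by move=> jn; rewrite nth_window // size_map (nth_total 0) // ltn_pmod.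
split=> [cov j|cy].
  have := covers_nth j cov; rewrite nthW // (nth_total 0) ?size_tuple //.
  by case=> // -[->]; rewrite (tnth_nth 0).
apply: coversP => [|s]; rewrite size_window; first by rewrite size_map size_tuple.
move=> sn; right; rewrite nthW // (nth_total 0) ?size_tuple //.
by rewrite (cy (Ordinal sn)) (tnth_nth 0).
Qed.

Lemma rot_window_bij i : (i < L)%N ->
  bijective (fun m : 'I_L => [ffun j : 'I_n => c (i + (m + j))]).
Proof.
move=> iL; have L0 := size_de_bruijn_gt0; set f := (X in bijective X).
have szw : size (Defs.total w) = L by rewrite size_map.
have f_inj : injective f.
  move=> m m' /ffunP eq_f; apply: val_inj.
  have lt_i (k : nat) : ((i + k) %% L < size (Defs.total w))%N by rewrite szw ltn_pmod.
  have [s [_ uniq_s]] := dbw [tuple c (i + (m + j)) | j < n].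
  have sE (k : 'I_L) : f k = f m -> s = Ordinal (lt_i k).
    move=> /ffunP fk; apply: uniq_s; apply/de_bruijn_covers => j /=.
    have := fk j; rewrite !ffunE tnth_mktuple => <-.
    by rewrite /c modnDml addnA.
  have := sE m erefl; rewrite (sE m'); last by apply/ffunP => j; rewrite eq_f.
  move=> /(congr1 val) /= /eqP; rewrite eqn_modDl !modn_small // => /eqP.
  exact: esym.
have f_surj y : exists m, f m == y.
  have [s [cov _]] := dbw [tuple y j | j < n].
  move/de_bruijn_covers: cov => cs.
  exists (Ordinal (ltn_pmod (s + (L - i)) L0)); apply/eqP/ffunP => j.
  rewrite ffunE /= -(tnth_mktuple y) -cs /c.
  rewrite addnCA modnDml (_ : s + (L - i) + (i + j) = s + j + L)%N ?modnDr //.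
  by clear -iL; lia.
exists (fun y => xchoose (f_surj y)) => [m|y]; last exact/eqP/(xchooseP (f_surj y)).
by apply: f_inj; apply/eqP/(xchooseP (f_surj (f m))).
Qed.

Let i0 := find (fun i => window 0 w i n == nseq n 0) (iota 0 L).

Lemma find_zeros : (i0 < L)%N /\ forall j, (j < n)%N -> c (i0 + j) = 0.
Proof.
have L0 := size_de_bruijn_gt0.
have hasz : has (fun i => window 0 w i n == nseq n 0) (iota 0 L).
  have [s [/de_bruijn_covers cs _]] := dbw [tuple 0 | _ < n].
  apply/hasP; exists (s : nat).
    by rewrite mem_iota /= add0n /L -(size_map some w).
  apply/eqP/(@eq_from_nth _ 0); rewrite size_window ?size_nseq // => j jn.
  by rewrite nth_window // nth_nseq jn -/(c _) (cs (Ordinal jn)) tnth_mktuple.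
have iL : (i0 < L)%N by rewrite -[X in (_ < X)%N](size_iota 0) -has_find.
split=> // j jn; have := nth_find 0%N hasz; rewrite nth_iota // add0n => /eqP.
by move/(congr1 (nth 0 ^~ j)); rewrite nth_window // nth_nseq jn.
Qed.

Lemma size_modified : size (modified n w) = L.-1.
Proof.
have [iL _] := find_zeros.
by rewrite /modified size_cat size_drop size_takel 1?ltnW // -/i0 -/L; lia.
Qed.

(** The deleted letter is the one at [i0], whence the successor: reading resumes right after it. *)
Lemma nth_modified m : (m < L.-1)%N ->
  nth 0 (modified n w) ((i0 + m) %% L.-1) = c (i0 + m.+1).
Proof.
move=> mL; have [iL _] := find_zeros.
rewrite /modified -/i0 nth_cat (size_takel (ltnW iL)) nth_drop.
have [imL|Lim] := ltnP (i0 + m) L.-1.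
  rewrite modn_small // ltnNge leq_addr /= /c modn_small; last by lia.
  by congr (nth _ _ _); lia.
have -> : (i0 + m = (i0 + m - L.-1) + L.-1)%N by lia.
have lti : (i0 + m - L.-1 < i0)%N by lia.
rewrite modnDr modn_small; last by lia.
rewrite lti nth_take // /c.
have -> : (i0 + m.+1 = (i0 + m - L.-1) + L)%N by lia.
by rewrite modnDr modn_small //; lia.
Qed.

End DeBruijn.

(** * The autocorrelation at shift N, and the conclusion *)

Lemma autocorrelation_split (R : realType) (F : finFieldType) (p k : nat)
    (x : seq F) (v : nat -> F) (i N : nat) :
  (N <= size x)%N ->
  (forall m, (m < size x)%N -> nth 0 x ((i + m) %% size x) = v m.+1) ->
  autocorrelation R p k x N%:Z =
    \sum_(1 <= j < (size x).+1 - N) chi R p k (v (j + N)%N - v j)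
    + \sum_(j < N) chi R p k (v j.+1 - v (j + ((size x).+1 - N))%N).
Proof.
set M := size x => NM xv.
have [M0|M_gt0] := posnP M.
  have N0 : N = 0%N by apply/eqP; rewrite -leqn0 -M0.
  rewrite /autocorrelation -/M M0 N0 !big_ord0 big_geq ?addr0 //.
pose h j := chi R p k (nth 0 x ((j + N) %% M) - nth 0 x (j %% M)).
transitivity (\sum_(j < M) h j).
  apply: eq_bigr => j _; rewrite /h /chi -PoszD modz_nat absz_nat.
  by rewrite [(j %% M)%N]modn_small.
rewrite -(@big_periodic_shift _ _ _ M i h); last first.
  by move=> j; rewrite /h addnAC !modnDr.
transitivity (\sum_(j < M) chi R p k (v ((j + N) %% M).+1 - v j.+1)).
  apply: eq_bigr => j _; rewrite /h -xv ?ltn_pmod // -xv //.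
  by rewrite modnDmr ![(i + _)%N]addnC addnAC.
rewrite -(big_mkord xpredT (fun j => chi R p k (v ((j + N) %% M).+1 - v j.+1))).
(* The last N indices wrap around and skip the deleted [v 0], so they land on [v j.+1] with j from
   0. *)
rewrite (@big_cat_nat _ _ _ (M - N)) //= ?leq_subr //; congr (_ + _).
  rewrite subSn // big_add1 /=; apply: eq_big_nat => j /andP[_ jMN].
  by rewrite modn_small ?addSn //; lia.
rewrite -{1}[(M - N)%N]add0n big_addn subKn // big_mkord; apply: eq_bigr => j _.
rewrite -addnA subnK // modnDr modn_small; last exact: leq_trans (ltn_ord j) NM.
by rewrite subSn // addnS.
Qed.

Theorem theorem7p19 (R : realType) (F : finFieldType) (p k n : nat)
    (u : seq (option F)) :
  prime p -> #|F| = (p ^ k)%N ->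
  (0 < n)%N -> upcycle n u -> diamondicity n u 1 -> nontrivial u ->
  forall w : seq F, de_bruijn_lift n 1 u w -> ~ R3_property R p k n w.
Proof.
move=> p_pr cardF n_gt0 _ du /andP[_ /hasP[l lu l_letter]] w [dbw [r0 cov]] R3.
pose N := size u; pose a := #|F|; pose L := (a * N)%N.
have N_gt0 : (0 < N)%N by rewrite /N; case: (u) lu.
have szU : size (cyclic_power (a ^ 1) u) = L by rewrite size_cyclic_power expn1.
have szw : size w = L by have := covers_size cov; rewrite size_rot szU size_map.
have {r0 cov} [r [rL cov]] : exists r, (r <= L)%N /\
    covers (rot r (cyclic_power (a ^ 1) u)) (Defs.total w).
  have [r0L|/ltnW Lr0] := leqP r0 L; first by exists r0.
  by exists 0%N; rewrite rot0; move: cov; rewrite rot_oversize ?szU.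
(* For n = 1 each window is a single diamond, contradicting the letter [l] of u. *)
have n_gt1 : (1 < n)%N.
  rewrite ltn_neqAle n_gt0 andbT; apply/eqP => n1; move: l_letter.
  have [s su <-] := (nthP None lu).
  have := diamond_window_sum s N_gt0 du.
  by rewrite -n1 big_ord1 addn0 modn_small //=; case: eqP.
have [i0L c_zeros] := find_zeros dbw.
set i0 := find _ _ in i0L c_zeros.
pose v m := nth 0 w ((i0 + m) %% size w).
(* [v] starts at [i0] in w, and position s of w is covered by position s + r of the power of u. *)
pose dia m := nth None u ((r + i0 + m) %% N) == None.
have letterE m : ~~ dia m -> nth None u ((r + i0 + m) %% N) = Some (v m).
  move=> dm; have L0 : (0 < L)%N by rewrite -szw (size_de_bruijn_gt0 dbw).
  have mL : ((i0 + m) %% L < L)%N by rewrite ltn_pmod.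
  have := covers_nth ((i0 + m) %% L) cov.
  rewrite nth_rot_mod ?szU // (nth_total 0) ?szw // modnDml nth_cyclic_power; last first.
    by rewrite expn1 ltn_pmod.
  rewrite modn_dvdm ?dvdn_mull // /v szw (_ : i0 + m + r = r + i0 + m)%N; last by lia.
  by case=> // dn; move: dm; rewrite /dia dn.
have dia_per m : dia (m + N)%N = dia m by rewrite /dia addnA modnDr.
have v_per m : v (m + L)%N = v m by rewrite /v szw addnA modnDr.
have v_letter m : ~~ dia m -> v (m + N)%N = v m.
  move=> dm; apply/Some_inj; rewrite -!letterE ?dia_per //.
  by rewrite addnA modnDr.
have dia_window m : (\sum_(j < n) dia (m + j) = 1)%N.
  rewrite -(diamond_window_sum (r + i0 + m) N_gt0 du).
  by apply: eq_bigr => j _; rewrite /dia addnA.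
have v_bij : bijective (fun m : 'I_L => [ffun j : 'I_n => v (m + j)%N]).
  by have := rot_window_bij dbw i0L; rewrite szw /v szw.
have N_gt1 : (1 < N)%N by exact: N_gt1 n_gt1 dia_per dia_window v_bij.
have a_gt1 : (1 < a)%N := finNzRing_gt1 F.
have szx : size (modified n w) = L.-1 by rewrite size_modified // szw.
have NL : (N < L.-1)%N by rewrite /L; clear - a_gt1 N_gt1; nia.
have ndvd : ~~ ((size (modified n w))%:Z %| N%:Z)%Z.
  by rewrite szx; apply/negP => /(dvdn_leq N_gt0); rewrite leqNgt NL.
have := R3 N%:Z ndvd.
rewrite (@autocorrelation_split _ _ _ _ _ v i0) ?szx ?(ltnW NL) //; last first.
  by move=> m; rewrite -szw => mL; exact: nth_modified.
rewrite prednK; last by rewrite muln_gt0 (ltnW a_gt1).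
(* If [chi] were trivial, the autocorrelation would be a natural number, hence not -1; so no
   surjectivity of the trace has to be shown. *)
have [/forallP triv|] := boolP [forall y : F, chi R p k y == 1].
  have chi1 (y : F) : chi R p k y = 1 by exact/eqP/triv.
  rewrite (eq_bigr (fun=> 1)) // [X in _ + X](eq_bigr (fun=> 1)) //.
  rewrite sumr_const_nat sumr_const -mulrnDr => /eqP.
  by rewrite -subr_eq0 opprK -(natrD _ _ 1) pnatr_eq0 addn1.
rewrite negb_forall => /existsP[y chiy] /(congr1 (@complex.Re R)).
rewrite ReD !Re_sum /= => ReA.
suff : (-1 < -1 :> R) by rewrite ltxx.
rewrite -[ltRHS]ReA.
apply: (@autocorrelation_bound R F (fun y => complex.Re (chi R p k y)) n N v dia) => //.
- by rewrite chi0.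
- by move=> z; exact: Re_chi_ge.
- by rewrite -Re_sum (sum_chi p_pr cardF chiy).
Qed.
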